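(* Let $X$ and $Y$ be Banach function spaces over $\mathbb{R}^n$ and let $0\le \alpha<n$. Suppose there is a constant $C$ such that for every cube $Q\subset\mathbb{R}^n$, $$|Q|^{-\frac{\alpha}{n}}\,\|\chi_Q\|_{Y'}\,\|\chi_Q\|_{X}\le C|Q| .$$ Let $T$ be a linear operator defined on $X$ which can be represented by $$Tf(x)=\int_{\mathbb{R}^n}K(x-y)f(y)\,dy \qquad\text{for all } x\notin \operatorname{supp}(f),$$ where $K$ is a homogeneous kernel of degree $-(n-\alpha)$, i.e. $K(\lambda x)=\lambda^{-(n-\alpha)}K(x)$ for all $\lambda>0$, $x\neq 0$. Suppose further that there exists a ball $B\subset\mathbb{R}^n$ on which $\frac1K$ has an absolutely convergent Fourier series. Let $b$ be a locally integrable function. If the commutator $[b,T]$ is bounded from $X$ to $Y$, then $b\in BMO(\mathbb{R}^n)$.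
   Context: Functions are real-valued on $\mathbb{R}^n$; cubes have sides parallel to the coordinate axes; $|Q|$ is Lebesgue measure. A Banach function space $X$ is a Banach space of measurable functions over $\mathbb{R}^n$ whose norm satisfies, for all $f,g\in X$: (1) $\|f\|_X=\||f|\|_X$; (2) if $|f|\le|g|$ a.e. then $\|f\|_X\le\|g\|_X$; (3) if $\{f_k\}\subset X$ and $|f_k|$ increases to $|f|$ a.e., then $\|f_k\|_X$ increases to $\|f\|_X$; (4) if $E\subset\mathbb{R}^n$ is bounded (measurable), then $\|\chi_E\|_X<\infty$; (5) if $E$ is bounded, then $\int_E|f(x)|\,dx\le C\|f\|_X$ with $C=C(E,X)$. The associate space $X'$ is the Banach function space with norm $\|g\|_{X'}=\sup\{\int_{\mathbb{R}^n}|f(x)g(x)|\,dx:\|f\|_X\le 1\}$; one has $\|f\|_X\approx\sup_{\|g\|_{X'}\le1}\int fg\,dx$ and $(X')'=X$. The commutator is $[b,T]f(x)=b(x)Tf(x)-T(bf)(x)$. ''$[b,T]$ is bounded from $X$ to $Y$'' (written $[b,T]:X\to Y$) means there is a constant $A$ with $\|[b,T]f\|_Y\le A\|f\|_X$ for all $f\in X$; it is implicit that $T$ also acts on the products $bf$, with the same integral representation off the support. ''$\frac1K$ has an absolutely convergent Fourier series on $B$'' means that $\frac{1}{K(x)}=\sum_j a_je^{i\nu_j\cdot x}$ for $x\in B$, with $\nu_j\in\mathbb{R}^n$ and $\sum_j|a_j|<\infty$. $b\in BMO(\mathbb{R}^n)$ means $\sup_Q\frac1{|Q|}\int_Q|b(x)-b_Q|\,dx<\infty$,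 where $b_Q=\frac1{|Q|}\int_Qb$. *)

(* Defs.v *)
From HB Require Import structures.
From mathcomp Require Import all_boot all_order all_algebra.
From mathcomp Require Import all_classical all_reals all_analysis.
From mathcomp.real_closed Require Import complex.

Set Implicit Arguments.
Unset Strict Implicit.
Unset Printing Implicit Defensive.

Import Order.TTheory GRing.Theory Num.Theory.
Import numFieldNormedType.Exports.

Local Open Scope classical_set_scope.
Local Open Scope ring_scope.

(* R^n. The alias carries the topology and the vector space structure of
   'rV[R]_n, and below the Lebesgue sigma-algebra. The norm of 'rV[R]_n is the
   sup norm, so Euclidean balls are written out explicitly. *)
Definition Rn (R : realType) (n : nat) := 'rV[R]_n.
HB.instance Definition _ (R : realType) (n : nat) :=
  NormedModule.copy (Rn R n) 'rV[R]_n.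

Section lebesgue_Rn.
Context {R : realType} {n : nat}.
Implicit Types (a b : Rn R n) (A : set (Rn R n)).

Definition box a b : set (Rn R n) :=
  [set x | forall i, a 0 i <= x 0 i <= b 0 i].

Definition box_vol a b : R := \prod_(i < n) (b 0 i - a 0 i).

(* countable families of boxes covering A; the family is indexed by D, so that
   it may be finite or empty *)
Definition box_cover A (D : pred nat) (a b : nat -> Rn R n) :=
  (forall k, D k -> forall i, a k 0 i <= b k 0 i) /\
  A `<=` \bigcup_(k in [set k | D k]) box (a k) (b k).

Definition lebesgue_outer A : \bar R :=
  ereal_inf [set v : \bar R | exists (D : pred nat) (a b : nat -> Rn R n),
    box_cover A D a b /\
    v = (\sum_(k <oo | D k) (box_vol (a k) (b k))%:E)%E].

Lemma box_vol_ge0 a b : (forall i, a 0 i <= b 0 i) -> 0 <= box_vol a b.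
Proof. by move=> ab; apply: prodr_ge0 => i _; rewrite subr_ge0. Qed.

Local Open Scope ereal_scope.

Lemma lebesgue_outer_ge0 A : 0 <= lebesgue_outer A.
Proof.
apply: le_ereal_inf_tmp => _ [D [a [b [[ab _] ->]]]].
by apply: nneseries_ge0 => k _ Dk; rewrite lee_fin box_vol_ge0//; exact: ab.
Qed.

Lemma lebesgue_outer0 : lebesgue_outer set0 = 0.
Proof.
apply/eqP; rewrite eq_le lebesgue_outer_ge0 andbT.
apply: ereal_inf_lbound; exists pred0, (fun=> 0%R), (fun=> 0%R); split; first by split.
by rewrite eseries_pred0.
Qed.

Lemma le_lebesgue_outer :
  {homo lebesgue_outer : A B / A `<=` B >-> A <= B}.
Proof.
move=> A B AB; apply: ereal_inf_le_tmp => _ [D [a [b [[ab Bab] ->]]]].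
by exists D, a, b; split=> //; split=> //; exact: subset_trans Bab.
Qed.

Lemma lebesgue_outer_sigma_subadditive : sigma_subadditive lebesgue_outer.
Proof.
move=> A; have [[i ioo]|] := pselect (exists i, lebesgue_outer (A i) = +oo).
  rewrite (eseries_pinfty _ _ ioo) ?leey// => k _.
  by rewrite -ltNye (lt_le_trans _ (lebesgue_outer_ge0 _)).
rewrite -forallNE => Aoo.
suff add2e (e : {posnum R}) : lebesgue_outer (\bigcup_k A k) <=
    \sum_(i <oo) lebesgue_outer (A i) + e%:num%:E.
  by apply/lee_addgt0Pr => _/posnumP[].
rewrite (le_trans _ (epsilon_trick _ _ _))//; last first.
  by move=> k; exact: lebesgue_outer_ge0.
pose cov := (pred nat * (nat -> Rn R n) * (nat -> Rn R n))%type.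
pose v (c : cov) k := if c.1.1 k then (box_vol (c.1.2 k) (c.2 k))%:E else 0.
pose P i (c : cov) := box_cover (A i) c.1.1 c.1.2 c.2 /\
  \sum_(k <oo) v c k <= lebesgue_outer (A i) + (e%:num / (2 ^ i.+1)%:R)%:E.
have [G PG] : {G : nat -> cov & forall i, P i (G i)}.
  apply: (@choice _ _ P) => i.
  have Afin : lebesgue_outer (A i) \is a fin_num.
    by rewrite ge0_fin_numE ?lebesgue_outer_ge0// ltey; exact/eqP/Aoo.
  have en1 : (0 < e%:num / (2 ^ i.+1)%:R)%R by [].
  have [x [D [a [b [cab ->]]]] xS] := lb_ereal_inf_adherent en1 Afin.
  by exists (D, a, b); split=> //; rewrite /v -eseries_mkcond; exact/ltW.
have v_ge0 (p : nat * nat) : 0 <= v (G p.1) p.2.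
  rewrite /v; case: ifPn => // Dp; rewrite lee_fin box_vol_ge0//.
  by case: (PG p.1) => -[+ _] _; exact.
have vG_ge0 (i j : nat) : 0 <= v (G i) j := v_ge0 (i, j).
apply: (@le_trans _ _ (\esum_(p in setT) v (G p.1) p.2)).
  have /card_esym/ppcard_eqP[f] := card_nat2.
  apply: ereal_inf_lbound.
  exists (fun k => (G (f k).1).1.1 (f k).2),
    (fun k => (G (f k).1).1.2 (f k).2), (fun k => (G (f k).1).2 (f k).2).
  split.
    split=> [k|x [i _ /(PG i).1.2[j Dj ijx]]].
      by case: (PG (f k).1) => -[+ _] _; exact.
    by exists (f^-1%FUN (i, j)); rewrite /= invK ?inE.
  rewrite eseries_mkcond -[RHS](eq_eseriesr (f := fun k => v (G (f k).1) (f k).2))//.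
  rewrite -(esum_pred_image (fun p => v (G p.1) p.2) f xpredT)//.
    congr esum; apply/esym/seteqP; split=> // p _.
    by exists (f^-1%FUN p) => //; exact: invK (in_setT _).
  by move=> i j _ _ /(congr1 f^-1%FUN); rewrite !funK ?inE.
rewrite (_ : esum _ _ = \sum_(i <oo) \sum_(j <oo) v (G i) j); last first.
  rewrite [LHS](_ : _ = \esum_(i in setT) \esum_(j in setT) v (G i) j).
    rewrite nneseries_esumT; last first.
      by move=> i; apply: nneseries_ge0 => j _ _; exact: vG_ge0.
    by apply: eq_esum => i _; rewrite nneseries_esumT// => j; exact: vG_ge0.
  rewrite (@esum_esum _ _ _ setT (fun=> setT)); last first.
    by move=> i j _ _; exact: vG_ge0.
  by congr esum; apply/seteqP; split.
apply: lee_lim.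
- apply: is_cvg_nneseries => i _ _.
  by apply: nneseries_ge0 => j _ _; exact: vG_ge0.
- apply: is_cvg_nneseries => i _ _.
  by apply: adde_ge0 => //; exact: lebesgue_outer_ge0.
- by near=> k; apply: lee_sum => i _; exact: (PG i).2.
Unshelve. all: by end_near. Qed.

HB.instance Definition _ := isOuterMeasure.Build R (Rn R n) lebesgue_outer
  lebesgue_outer0 lebesgue_outer_ge0 le_lebesgue_outer
  lebesgue_outer_sigma_subadditive.

End lebesgue_Rn.

Definition lebesgue_display (R : realType) (n : nat) : measure_display :=
  caratheodory_display (@lebesgue_outer R n).

(* This sigma-algebra is complete: it consists of all Lebesgue measurable sets,
   not only of the Borel sets. *)
HB.instance Definition _ (R : realType) (n : nat) :=
  @isMeasurable.Build (lebesgue_display R n) (Rn R n)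
    (@lebesgue_outer R n).-caratheodory
    (caratheodory_measurable_set0 (@lebesgue_outer R n))
    (@caratheodory_measurable_setC _ _ (@lebesgue_outer R n))
    (@caratheodory_measurable_bigcup _ _ (@lebesgue_outer R n)).

Definition lebn (R : realType) (n : nat) : set (Rn R n) -> \bar R :=
  @lebesgue_outer R n.

HB.instance Definition _ (R : realType) (n : nat) :=
  isMeasure.Build _ (Rn R n) R (@lebn R n)
    (@caratheodory_measure0 R (Rn R n) (@lebesgue_outer R n))
    (@caratheodory_measure_ge0 R (Rn R n) (@lebesgue_outer R n))
    (@caratheodory_measure_sigma_additive R (Rn R n) (@lebesgue_outer R n)).

Section definitions.
Context {R : realType} {n : nat}.
Local Notation E := (Rn R n).
Local Notation mu := (@lebn R n).

Definition is_cube (Q : set E) : Prop :=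
  exists (a : E) (l : R),
    0 < l /\ Q = [set x | forall i, a 0 i <= x 0 i <= a 0 i + l].

Definition dot (x y : E) : R := \sum_(i < n) x 0 i * y 0 i.

Definition euclidean_ball (z : E) (r : R) : set E :=
  [set x | Num.sqrt (dot (x - z) (x - z)) < r].

Definition supp (f : E -> R) : set E := closure [set x | f x != 0].

(* The norm is extended to all measurable functions by +oo outside the space,
   which is then the set of measurable functions of finite norm. Values on
   non-measurable functions are irrelevant. *)
Record banach_function_space := BanachFunctionSpace {
  bfs_norm :> (E -> R) -> \bar R ;
  bfs_norm_ge0 : forall f : E -> R, measurable_fun setT f -> (0 <= bfs_norm f)%E ;
  bfs_norm_eq0 : forall f : E -> R, measurable_fun setT f ->
    bfs_norm f = 0%E <-> {ae mu, forall x, f x = 0} ;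
  bfs_normZ : forall (c : R) (f : E -> R), measurable_fun setT f ->
    bfs_norm (fun x => c * f x) = (`|c|%:E * bfs_norm f)%E ;
  bfs_normD : forall f g : E -> R, measurable_fun setT f -> measurable_fun setT g ->
    (bfs_norm (fun x => f x + g x)%R <= bfs_norm f + bfs_norm g)%E ;
  bfs_complete : forall u : nat -> E -> R,
    (forall k, measurable_fun setT (u k) /\ (bfs_norm (u k) < +oo)%E) ->
    (forall e : R, 0 < e -> exists M : nat, forall i j : nat,
      (M <= i)%N -> (M <= j)%N ->
      (bfs_norm (fun x => u i x - u j x)%R < e%:E)%E) ->
    exists f : E -> R, [/\ measurable_fun setT f, (bfs_norm f < +oo)%E &
      bfs_norm (fun x => u k x - f x) @[k --> \oo] --> 0%E] ;
  bfs_norm_abs : forall f : E -> R, measurable_fun setT f ->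
    bfs_norm f = bfs_norm (fun x => `|f x|) ;
  bfs_norm_le : forall f g : E -> R, measurable_fun setT f -> measurable_fun setT g ->
    {ae mu, forall x, `|f x| <= `|g x|} -> (bfs_norm f <= bfs_norm g)%E ;
  bfs_norm_cvg : forall (u : nat -> E -> R) (f : E -> R),
    (forall k, measurable_fun setT (u k) /\ (bfs_norm (u k) < +oo)%E) ->
    measurable_fun setT f ->
    {ae mu, forall x, nondecreasing_seq (fun k => `|u k x|) /\
                      `|u k x| @[k --> \oo] --> `|f x|} ->
    nondecreasing_seq (fun k => bfs_norm (u k)) /\
    bfs_norm (u k) @[k --> \oo] --> bfs_norm f ;
  bfs_norm_indic : forall A : set E, measurable A -> bounded_set A ->
    (bfs_norm \1_A < +oo)%E ;
  bfs_le_integral : forall A : set E, measurable A -> bounded_set A ->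
    exists C : R, forall f : E -> R, measurable_fun setT f -> (bfs_norm f < +oo)%E ->
      (\int[mu]_(x in A) `|f x|%:E <= C%:E * bfs_norm f)%E
}.

Definition bfs_set (X : banach_function_space) : set (E -> R) :=
  [set f : E -> R | measurable_fun setT f /\ (X f < +oo)%E].

Definition assoc_norm (X : banach_function_space) (g : E -> R) : \bar R :=
  ereal_sup [set (\int[mu]_x `|f x * g x|%:E)%E |
             f in [set f : E -> R | measurable_fun setT f /\ (X f <= 1)%E]].

(* Functions are representatives of classes modulo a.e. equality, hence
   linearity is only required almost everywhere. *)
Definition linear_operator_on (X : banach_function_space)
    (T : (E -> R) -> E -> R) : Prop :=
  forall (c : R) (f g : E -> R), bfs_set X f -> bfs_set X g ->
    {ae mu, forall x, T (fun y => c * f y + g y) x = c * T f x + T g x}.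

Definition represented_off_support (T : (E -> R) -> E -> R) (K : E -> R)
    (f : E -> R) : Prop :=
  forall x, ~ supp f x ->
    mu.-integrable setT (fun y => (K (x - y)%R * f y)%:E) /\
    T f x = \int[mu]_y (K (x - y) * f y).

(* K is real-valued on all of R^n; its value at 0 is unconstrained *)
Definition homogeneous_kernel (K : E -> R) (d : R) : Prop :=
  forall (lambda : R) (x : E), 0 < lambda -> x != 0 ->
    K (lambda *: x) = lambda `^ d * K x.

Definition expi (t : R) : R[i] := (cos t +i* sin t)%C.

Definition abs_cvg_fourier (g : E -> R) (B : set E) : Prop :=
  exists (a : nat -> R[i]^o) (nu : nat -> E),
    cvgn [normed series a] /\
    forall x, B x ->
      series (fun j => a j * expi (dot (nu j) x) : R[i]^o) @ \oo -->
        ((g x)%:C%C : R[i]^o).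

Definition commutator (b : E -> R) (T : (E -> R) -> E -> R) (f : E -> R) :
    E -> R :=
  fun x => b x * T f x - T (fun y => b y * f y) x.

Definition bounded_operator (X Y : banach_function_space)
    (S : (E -> R) -> E -> R) : Prop :=
  exists A : R, forall f : E -> R, bfs_set X f ->
    measurable_fun setT (S f) /\ (Y (S f) <= A%:E * X f)%E.

Definition locally_integrable_Rn (b : E -> R) : Prop :=
  measurable_fun setT b /\
  forall A : set E, compact A -> (\int[mu]_(x in A) `|b x|%:E < +oo)%E.

Definition average (b : E -> R) (Q : set E) : R :=
  (fine (mu Q))^-1 * \int[mu]_(x in Q) b x.

Definition BMO (b : E -> R) : Prop :=
  locally_integrable_Rn b /\
  (ereal_sup [set ((fine (mu Q))^-1%:E *
                   \int[mu]_(x in Q) `|b x - average b Q|%:E)%E |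
              Q in is_cube] < +oo)%E.

End definitions.

Arguments banach_function_space : clear implicits.

(* Main.v *)
Require Import Defs.
From mathcomp Require Import all_boot all_order all_algebra.
From mathcomp Require Import all_classical all_reals all_analysis.
From mathcomp.real_closed Require Import complex.
From mathcomp Require Import measurable_realfun ring lra.
Import Order.TTheory GRing.Theory Num.Theory.
Import numFieldNormedType.Exports.
Local Open Scope classical_set_scope.
Local Open Scope ring_scope.

(* Let [Q] be a cube of side [r] and [Q'] its translate by [- s w0], where [s] is
   a fixed multiple of [r] so large that [(x - y) / s] stays, for [x] in [Q] and
   [y] in [Q'], in a small box around [w0] on which [1 / K] has an absolutely
   convergent Fourier series and which does not contain 0. By homogeneity
   [1 = s^(n - alpha) K(x - y) / K((x - y) / s)], and expanding the last factor,
   whose terms are combinations of products of a bounded function of [x] and a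
   bounded function of [y], gives for each [x] in [Q]
     [|Q'| |b x - b_Q'| <= s^(n - alpha) sum_j m_j |[b,T]f_j x|]
   with [sum_j m_j < +oo] and [|f_j| <= 1_Q']. Integrating over [Q], the
   boundedness of [b,T] and the hypothesis on a cube containing [Q] and [Q'] bound
   the mean oscillation of [b] around [b_Q'] over [Q]. *)

(** * Lebesgue measure of cubes and measurability of coordinates *)

Section Rn_measure.
Context {R : realType} {n : nat}.
Implicit Types (a b x y z : Rn R n) (i : 'I_n) (c l : R).
Local Notation mu := (@lebn R n).

Lemma box_vol_split (i : 'I_n) (m : R) a b :
  box_vol a (\row_j (if j == i then m else b 0 j)) +
  box_vol (\row_j (if j == i then m else a 0 j)) b = box_vol a b.
Proof.
rewrite /box_vol (bigD1 i)//= [X in _ + X](bigD1 i)//= [RHS](bigD1 i)//=.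
rewrite !mxE eqxx.
rewrite (eq_bigr (fun j => b 0 j - a 0 j)); last first.
  by move=> j /negPf ji; rewrite mxE ji.
rewrite [X in _ + _ * X](eq_bigr (fun j => b 0 j - a 0 j)); last first.
  by move=> j /negPf ji; rewrite mxE ji.
by rewrite -mulrDl addrC addrA subrK.
Qed.

(** Cutting every box of a cover of [A] along the hyperplane yields covers of the two pieces of [A],
    and the volumes of the halves add up to the volume of the box. *)
Lemma measurable_halfspace i c : measurable [set x : Rn R n | x 0 i <= c].
Proof.
apply: (@le_caratheodory_measurable R (Rn R n) (@lebesgue_outer R n)) => /= A.
apply: le_ereal_inf_tmp => _ [D [a [b [[ab Aab] ->]]]].
(* [m k] is [c] clamped to the [i]-th edge of the box, so both halves are genuine boxes; one of them
   has volume 0 if the hyperplane misses the box. *)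
pose m k := Num.max (a k 0 i) (Num.min (b k 0 i) c).
have am k : D k -> a k 0 i <= m k by move=> _; rewrite le_max lexx.
have mb k : D k -> m k <= b k 0 i.
  by move=> Dk; rewrite ge_max ab//= ge_min lexx.
pose bm k : Rn R n := \row_j (if j == i then m k else b k 0 j).
pose am' k : Rn R n := \row_j (if j == i then m k else a k 0 j).
have abm k : D k -> forall j, a k 0 j <= bm k 0 j.
  by move=> Dk j; rewrite mxE; case: eqP => [->|_]; [exact: am|exact: ab].
have amb k : D k -> forall j, am' k 0 j <= b k 0 j.
  by move=> Dk j; rewrite mxE; case: eqP => [->|_]; [exact: mb|exact: ab].
rewrite (eq_eseriesr (g := fun k => ((box_vol (a k) (bm k))%:E +
    (box_vol (am' k) (b k))%:E)%E)); last first.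
  by move=> k Dk; rewrite -EFinD box_vol_split.
rewrite nneseriesD; last 2 first.
- by move=> k _ Dk; rewrite lee_fin; apply: box_vol_ge0; exact: abm.
- by move=> k _ Dk; rewrite lee_fin; apply: box_vol_ge0; exact: amb.
apply: leeD; apply: ereal_inf_lbound.
- exists D, a, bm; split=> //; split=> // x [/Aab[k Dk abx] /= xc].
  exists k => // j; have /andP[aj bj] := abx j; rewrite aj mxE.
  by case: eqP => [->|//]; rewrite le_max le_min xc (andP (abx i)).2 orbT.
- exists D, am', b; split=> //; split=> // x [/Aab[k Dk abx] /= /negP].
  rewrite -ltNge => cx.
  exists k => // j; have /andP[aj bj] := abx j; rewrite bj mxE andbT.
  case: eqP => [->|//]; rewrite ge_max (andP (abx i)).1 /= ge_min (ltW cx).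
  by rewrite orbT.
Qed.

Lemma measurable_coord i : measurable_fun setT (fun x : Rn R n => x 0 i).
Proof.
apply: (measurability _ (RGenOInfty.measurableE R)) => //.
move=> _ [_ [c ->] <-]; rewrite setTI.
rewrite (_ : _ @^-1` _ = ~` [set x : Rn R n | x 0 i <= c]).
  by apply: measurableC; exact: measurable_halfspace.
by apply/seteqP; split => x /=; rewrite in_itv/= andbT ltNge => /negP.
Qed.

Lemma measurable_dot (u : Rn R n) : measurable_fun setT (dot u).
Proof.
rewrite /dot; apply: measurable_sum => i.
by apply: measurable_funM => //; exact: measurable_coord.
Qed.

Definition cube a l : set (Rn R n) :=
  [set x | forall i, a 0 i <= x 0 i <= a 0 i + l].

Lemma is_cube_cube a l : 0 < l -> is_cube (cube a l).
Proof. by move=> l0; exists a, l. Qed.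

Lemma compact_cube a l : compact (cube a l).
Proof.
apply: (@rV_compact R n (fun i => `[a 0 i, a 0 i + l]%classic)) => i.
exact: segment_compact.
Qed.

Lemma bounded_cube a l : bounded_set (cube a l).
Proof. exact: (compact_bounded (compact_cube a l)). Qed.

Lemma closed_cube a l : closed (cube a l).
Proof. apply: compact_closed; [exact: norm_hausdorff|exact: compact_cube]. Qed.

Lemma measurable_cube a l : measurable (cube a l).
Proof.
rewrite (_ : cube a l =
    \bigcap_(i in setT) ((fun x : Rn R n => x 0 i) @^-1` `[a 0 i, a 0 i + l])).
  apply: fin_bigcap_measurable => // i _.
  by rewrite -[X in measurable X]setTI; exact: measurable_coord.
apply/seteqP; split => x /= ax i; first by move=> _ /=; rewrite in_itv/=; exact: ax.
by have := ax i Logic.I; rewrite /= in_itv.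
Qed.

(** The images of the boxes of a cover are boxes whose volumes are multiplied by [t ^+ n]. One
    inequality is enough: applied to the inverse map it gives the other one. *)
Lemma lebesgue_outer_affine (t : R) (v : Rn R n) (A : set (Rn R n)) : 0 < t ->
  (lebesgue_outer [set (t *: x + v)%R | x in A] <=
   (t ^+ n)%:E * lebesgue_outer A)%E.
Proof.
move=> t0; rewrite -lee_pdivrMl ?exprn_gt0//.
apply: le_ereal_inf_tmp => _ [D [a [b [[ab Aab] ->]]]].
rewrite lee_pdivrMl ?exprn_gt0// -nneseriesZl; last first.
  by move=> k Dk; rewrite lee_fin; apply: box_vol_ge0; exact: ab.
apply: ereal_inf_lbound.
exists D, (fun k => t *: a k + v), (fun k => t *: b k + v); split.
  split=> [k Dk i|_ [x /Aab[k Dk abx] <-]].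
    by rewrite !mxE lerD2r ler_pM2l ?ab.
  by exists k => // i; rewrite !mxE !lerD2r !ler_pM2l ?abx.
apply: eq_eseriesr => k Dk; rewrite -EFinM; congr EFin.
rewrite /box_vol -[X in t ^+ X](card_ord n) -prodr_const -big_split /=.
by apply: eq_bigr => i _; rewrite !mxE; ring.
Qed.

Lemma cube_affine a l : 0 < l ->
  cube a l = [set (l *: x + a)%R | x in cube 0 1].
Proof.
move=> l0; apply/seteqP; split => [x ax|_ [x x01 <-] i].
  exists (l^-1 *: (x - a)); last by rewrite scalerA divff ?gt_eqF// scale1r subrK.
  move=> i; rewrite !mxE add0r ler_pdivlMl// ler_pdivrMl// mulr0 mulr1.
  by rewrite subr_ge0 lerBlDl; exact: ax.
have := x01 i; rewrite !mxE add0r => /andP[x0 x1].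
apply/andP; split; first by rewrite lerDr mulr_ge0// ltW.
by rewrite [leRHS]addrC lerD2r ler_piMr// ltW.
Qed.

(** The measure of the unit cube stays an unspecified constant: the argument uses its finiteness,
    and its positivity comes with the cubes for which an estimate is required. *)
Lemma lebn_cube a l : 0 < l -> mu (cube a l) = ((l ^+ n)%:E * mu (cube 0%R 1%R))%E.
Proof.
move=> l0; apply/eqP; rewrite eq_le {1}cube_affine// lebesgue_outer_affine//=.
rewrite -lee_pdivlMl ?exprn_gt0// -exprVn.
apply: le_trans (lebesgue_outer_affine _ (- (l^-1 *: a)) _ _); rewrite ?invr_gt0//.
apply: le_lebesgue_outer => x x01; exists (l *: x + a).
  by rewrite cube_affine//; exists x.
by rewrite scalerDr scalerA mulVf ?gt_eqF// scale1r addrK.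
Qed.

Lemma lebn_unit_cube_fin : mu (cube 0 1) \is a fin_num.
Proof.
rewrite ge0_fin_numE//; apply: (@le_lt_trans _ _ 1%E); last exact: ltry.
apply: (@le_trans _ _ (\sum_(k <oo | pred1 0%N k)
    (box_vol (0 : Rn R n) (const_mx 1))%:E)%E).
  apply: ereal_inf_lbound; exists (pred1 0%N), (fun=> 0), (fun=> const_mx 1).
  split=> //; split=> [k _ i|x x01]; first by rewrite !mxE ler01.
  by exists 0%N => //= i; have := x01 i; rewrite !mxE add0r.
rewrite (nneseriesD1 (n := 0%N))//; last first.
  by move=> k _; rewrite lee_fin; apply: box_vol_ge0 => i; rewrite !mxE ler01.
rewrite eseries_pred0 ?adde0; last by move=> k /=; case: eqP.
by rewrite /box_vol big1// => i _; rewrite !mxE subr0.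
Qed.

End Rn_measure.

(** * Real form of an absolutely convergent Fourier series *)

Section complex_series.
Context {R : realType}.

Lemma ReD (z w : R[i]) : complex.Re (z + w) = complex.Re z + complex.Re w.
Proof. by case: z w => [x y] [x' y']. Qed.

Lemma normr_Re_le (z : R[i]) : (`|complex.Re z|%:C <= `|z|)%C.
Proof. by rewrite normc_def lecR -sqrtr_sqr ler_wsqrtr// lerDl sqr_ge0. Qed.

Lemma normr_Im_le (z : R[i]) : (`|complex.Im z|%:C <= `|z|)%C.
Proof. by rewrite normc_def lecR -sqrtr_sqr ler_wsqrtr// lerDr sqr_ge0. Qed.

Lemma cvg_Re (u : nat -> R[i]^o) (l : R[i]^o) : u @ \oo --> l ->
  complex.Re (u k) @[k --> \oo] --> complex.Re l.
Proof.
move=> ul; apply/cvgrPdist_lt => e e0.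
move/cvgrPdist_lt : ul => /(_ e%:C%C); rewrite ltcR => /(_ e0).
apply: filterS => k; rewrite -ltcR; apply: le_lt_trans.
by apply: le_trans (normr_Re_le _); rewrite lecR; case: l (u k) => [x y] [x' y'].
Qed.

Lemma Re_series (u : nat -> R[i]^o) k :
  complex.Re (series u k) = series (fun j => complex.Re (u j)) k.
Proof. by rewrite /series/= (big_morph _ ReD erefl). Qed.

(** Real parts are taken termwise: for [a = p + i q], the real part of [a * expi t] is
    [p * cos t - q * sin t], and the moduli of [p] and [q] are at most that of [a]. *)
Lemma abs_cvg_fourier_real n (g : Rn R n -> R) (B : set (Rn R n)) :
  abs_cvg_fourier g B ->
  exists (p q : nat -> R) (nu : nat -> Rn R n),
    cvgn (series (fun j => `|p j| + `|q j|)) /\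
    forall x, B x -> series (fun j => p j * cos (dot (nu j) x) -
                                      q j * sin (dot (nu j) x)) @ \oo --> g x.
Proof.
move=> [a [nu [cva ag]]].
exists (fun j => complex.Re (a j)), (fun j => complex.Im (a j)), nu; split.
  (* The modulus of [a j] is an element of [R[i]] with zero imaginary part; [r j] is its value in
     [R]. *)
  pose r j := complex.Re `|a j|.
  have pr j : `|complex.Re (a j)| <= r j.
    by have := normr_Re_le (a j); rewrite lecE => /andP[].
  have qr j : `|complex.Im (a j)| <= r j.
    by have := normr_Im_le (a j); rewrite lecE => /andP[].
  have r0 j : 0 <= r j by exact: le_trans (pr j).
  have cr : cvgn (series r).
    move/cvg_ex : cva => [l /cvg_Re].
    under eq_cvg do rewrite Re_series.
    by move=> /cvgP.
  apply: is_cvg_seriesD; exact: series_le_cvg cr.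
move=> x /ag /cvg_Re; under eq_cvg do rewrite Re_series.
rewrite [X in series X](_ : _ = (fun j => complex.Re (a j) * cos (dot (nu j) x) -
    complex.Im (a j) * sin (dot (nu j) x)))//.
by apply/funext => j; rewrite /expi; case: (a j).
Qed.

End complex_series.

(** * Bounded mean oscillation tested with arbitrary constants *)

Section BMO_criterion.
Context {R : realType} {n : nat}.
Local Notation mu := (@lebn R n).

Lemma lebn_cube_fin (a : Rn R n) l : 0 < l -> mu (cube a l) \is a fin_num.
Proof. by move=> l0; rewrite lebn_cube// fin_numM// lebn_unit_cube_fin. Qed.

Lemma integrable_cube (b : Rn R n -> R) (a : Rn R n) l : locally_integrable_Rn b ->
  mu.-integrable (cube a l) (EFin \o b).
Proof.
move=> [mb ib]; apply/integrableP; split.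
  by apply/measurable_EFinP; exact: measurable_funTS.
by apply: ib; exact: compact_cube.
Qed.

(** Replacing [c] by the average costs a factor 2, because |b_Q - c| |Q| is at most the integral of
    |b - c| over Q. *)
Lemma BMO_of_constants (b : Rn R n -> R) (E : R) : locally_integrable_Rn b ->
  (forall a l, 0 < l -> (0 < mu (cube a l))%E -> exists c : R,
    (\int[mu]_(x in cube a l) `|b x - c|%:E <= E%:E * mu (cube a l))%E) ->
  BMO b.
Proof.
(* [E] may have any sign; its absolute value gives a nonnegative bound, as null cubes require. *)
move=> hb hE; split=> //; apply: (@le_lt_trans _ _ (2 * `|E|)%:E); last exact: ltry.
apply: ge_ereal_sup => _ [_ [a [l [l0 ->]]] <-].
rewrite -/(cube a l); set Q := cube a l.
have [v v0 muQ] : exists2 v : R, 0 <= v & mu Q = v%:E.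
  have := lebn_cube_fin a l l0; rewrite -/Q => Qfin.
  by exists (fine (mu Q)); rewrite ?fineK// fine_ge0.
rewrite muQ /=.
have [v00|vN0] := eqVneq v 0.
  (* the average over a null cube is 0 because 0^-1 = 0 *)
  by rewrite v00 invr0 mul0e lee_fin mulr_ge0.
have v_gt0 : 0 < v by rewrite lt_neqAle eq_sym vN0.
have mQm : measurable Q by exact: measurable_cube.
have [|c] := hE a l l0; first by rewrite -/Q muQ.
rewrite -/Q muQ => hc.
have ib : mu.-integrable Q (EFin \o b) by exact: integrable_cube.
have ic d : mu.-integrable Q (EFin \o cst d).
  apply/integrableP; split; first by apply/measurable_EFinP; exact: measurable_cst.
  by rewrite /= (integral_cst mu mQm `|d|%:E)/= muQ -EFinM ltry.
have ibc d : mu.-integrable Q (EFin \o (fun x => b x - d)).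
  rewrite (_ : _ \o _ = (EFin \o b) \- (EFin \o cst d))%E//.
  exact: integrableB.
have inbc d : mu.-integrable Q (EFin \o (fun x => `|b x - d|)).
  exact: integrable_norm (ibc d).
have IE d : (\int[mu]_(x in Q) `|b x - d|%:E = (\int[mu]_(x in Q) `|b x - d|)%:E)%E.
  by rewrite /Rintegral fineK//; exact: integrable_fin_num (inbc d).
rewrite IE -EFinM lee_fin ler_pdivrMl//.
have {hc} hc : \int[mu]_(x in Q) `|b x - c| <= E * v.
  by rewrite -lee_fin -IE EFinM.
have avgc : `|average b Q - c| * v <= \int[mu]_(x in Q) `|b x - c|.
  apply: le_trans (le_normr_Rintegral mQm (ibc c)).
  rewrite (RintegralB mQm ib (ic c)) Rintegral_cst//= muQ/= /average muQ/=.
  rewrite -[X in _ * X](gtr0_norm v_gt0) -normrM mulrBl mulrAC mulVf ?gt_eqF//.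
  by rewrite mul1r.
apply: (@le_trans _ _ (\int[mu]_(x in Q) (`|b x - c| + `|average b Q - c|))).
  apply: le_Rintegral => //.
    rewrite (_ : _ \o _ = (EFin \o (fun x => `|b x - c|%R)) \+
        (EFin \o cst `|average b Q - c|%R))%E//.
    by apply: integrableD => //; exact: inbc.
  by move=> x _; rewrite [X in _ <= _ + X]distrC ler_distD.
rewrite (RintegralD mQm (inbc c) (ic _)) Rintegral_cst//= muQ/=.
have Ev : E * v <= `|E| * v by exact: ler_wpM2r (ler_norm E).
rewrite mulrCA mulr_natl mulr2n [v * _]mulrC.
by apply: lerD; apply: le_trans Ev => //; exact: le_trans avgc hc.
Qed.

End BMO_criterion.

(** * Duality with the associate space *)

Section associate_space.
Context {R : realType} {n : nat}.
Local Notation mu := (@lebn R n).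

(** Hölder's inequality, obtained by testing the supremum with [F / M]. A positive bound [M] stands
    in for the norm of [F], which may be 0 and then cannot be divided by. *)
Lemma le_integral_assoc_norm (Y : banach_function_space R n) (F : Rn R n -> R)
    (M : R) (P : set (Rn R n)) :
  measurable_fun setT F -> measurable P -> 0 < M -> (Y F <= M%:E)%E ->
  (\int[mu]_(x in P) `|F x|%:E <= M%:E * assoc_norm Y \1_P)%E.
Proof.
move=> mF mP M0 YF; pose f x := M^-1 * F x.
have mf : measurable_fun setT f by exact: measurable_funM.
have Yf : (Y f <= 1)%E.
  by rewrite bfs_normZ// gtr0_norm ?invr_gt0// lee_pdivrMl// mule1.
have fP : (\int[mu]_x `|f x * \1_P x|%:E <= assoc_norm Y \1_P)%E.
  by apply: ereal_sup_ubound; exists f.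
apply: le_trans (lee_wpmul2l _ fP); last by rewrite lee_fin ltW.
rewrite -ge0_integralZl//; last 2 first.
- apply/measurable_EFinP; apply: measurableT_comp; first exact: normr_measurable.
  by apply: measurable_funM => //; exact: measurable_indic.
- by rewrite lee_fin ltW.
rewrite [leLHS]integral_mkcond le_eqVlt; apply/orP; left; apply/eqP.
apply: eq_integral => x _; rewrite patchE indicE -EFinM /f.
case: ifPn => _; rewrite ?mulr1 ?mulr0 ?normr0 ?mulr0//.
by rewrite normrM gtr0_norm ?invr_gt0// mulrA divff ?mul1r// gt_eqF.
Qed.

End associate_space.

(** * Termwise integration of a Fourier expansion *)

Section fourier_expansion.
Context {d} {T : measurableType d} {R : realType}.
Context {mu : {measure set T -> \bar R}}.

Lemma integrable_bounded_mul (h u : T -> R) (M : R) :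
  mu.-integrable setT (EFin \o h) -> measurable_fun setT u ->
  (forall y, `|u y| <= M) ->
  mu.-integrable setT (EFin \o (fun y => h y * u y)).
Proof.
move=> ih mu_ uM.
apply: (@le_integrable _ _ _ mu setT _ _ (fun y => (M%:E * (EFin \o h) y)%E)) => //.
- apply/measurable_EFinP; apply: measurable_funM => //.
  by apply/measurable_EFinP; exact: measurable_int ih.
- move=> y _ /=; rewrite lee_fin !normrM mulrC ler_wpM2r//.
  exact: le_trans (ler_norm M).
- exact: integrableZl.
Qed.

(* Splitting [cos (theta - phi)] and [sin (theta - phi)] by the addition
   formulas separates the variables, and dominated convergence allows to
   integrate the resulting series termwise. *)
Lemma normr_integral_fourier_le (h g : T -> R) (p q theta : nat -> R)
    (phi : nat -> T -> R) :
  mu.-integrable setT (EFin \o h) ->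
  (forall j, measurable_fun setT (phi j)) ->
  cvgn (series (fun j => `|p j| + `|q j|)) ->
  (forall y, h y != 0 -> series (fun j => p j * cos (theta j - phi j y) -
                                q j * sin (theta j - phi j y)) @ \oo --> g y) ->
  (`|\int[mu]_y (h y * g y)%:E| <= \sum_(j <oo)
    ((`|p j| + `|q j|) * (`|\int[mu]_y (h y * cos (phi j y))|
                        + `|\int[mu]_y (h y * sin (phi j y))|))%:E)%E.
Proof.
move=> ih mphi cpq hg.
pose m j : R := `|p j| + `|q j|.
pose e y j : R := p j * cos (theta j - phi j y) - q j * sin (theta j - phi j y).
pose C j := \int[mu]_y (h y * cos (phi j y)).
pose S j := \int[mu]_y (h y * sin (phi j y)).
(* [U j] and [V j] are the coefficients of [cos (phi j y)] and [sin (phi j y)] in the [j]-th term;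
   they do not depend on [y]. *)
pose U j := p j * cos (theta j) - q j * sin (theta j).
pose V j := p j * sin (theta j) + q j * cos (theta j).
have cos1 t : `|cos t : R| <= 1 by rewrite ler_norml cos_geN1 cos_le1.
have sin1 t : `|sin t : R| <= 1 by rewrite ler_norml sin_geN1 sin_le1.
have wle (a c : R) : `|c| <= 1 -> `|a * c| <= `|a|.
  by move=> c1; rewrite normrM ler_piMr.
have Um j : `|U j| <= m j.
  by apply: le_trans (ler_normB _ _) _; apply: lerD; exact: wle.
have Vm j : `|V j| <= m j.
  by apply: le_trans (ler_normD _ _) _; apply: lerD; exact: wle.
have em y j : `|e y j| <= m j.
  by apply: le_trans (ler_normB _ _) _; apply: lerD; exact: wle.
have eUV y j : e y j = U j * cos (phi j y) + V j * sin (phi j y).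
  by rewrite /e /U /V cosB sinB; ring.
have mcos j : measurable_fun setT (fun y => cos (phi j y)).
  apply: measurableT_comp (mphi j); apply: continuous_measurable_fun.
  exact: continuous_cos.
have msin j : measurable_fun setT (fun y => sin (phi j y)).
  apply: measurableT_comp (mphi j); apply: continuous_measurable_fun.
  exact: continuous_sin.
have iC j : mu.-integrable setT (EFin \o (fun y => h y * cos (phi j y))).
  exact: integrable_bounded_mul (fun y => cos1 (phi j y)).
have iS j : mu.-integrable setT (EFin \o (fun y => h y * sin (phi j y))).
  exact: integrable_bounded_mul (fun y => sin1 (phi j y)).
have mh : measurable_fun setT h by apply/measurable_EFinP; exact: measurable_int ih.
have me j : measurable_fun setT (fun y => e y j).
  under eq_fun do rewrite eUV.
  by apply: measurable_funD; apply: measurable_funM.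
pose F N y := h y * series (e y) N.
have mF N : measurable_fun setT (F N).
  by apply: measurable_funM => //; apply: measurable_sum => j; exact: me.
(* This bound is uniform in [y] and [N], so that [limn (series m)] times |h| is the dominating
   function below. *)
have seM y N : `|series (e y) N| <= limn (series m).
  apply: le_trans (ler_norm_sum _ _ _) _.
  apply: (@le_trans _ _ (series m N)); first by apply: ler_sum => j _; exact: em.
  apply: nondecreasing_cvgn_le => //; apply: nondecreasing_series => j _ _.
  by rewrite addr_ge0.
have iF N : mu.-integrable setT (EFin \o F N).
  apply: (integrable_bounded_mul h (fun y => series (e y) N) _ ih) => //.
  by apply: measurable_sum => j; exact: me.
have FE N : \int[mu]_y F N y = \sum_(0 <= j < N) (U j * C j + V j * S j).
  elim: N => [|N IHN].
    rewrite big_nil; under eq_Rintegral do rewrite /F /series/= big_geq// mulr0.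
    by rewrite Rintegral_cst// mul0r.
  rewrite big_nat_recr//= -IHN -!RintegralZl//.
  have iUC : mu.-integrable setT (EFin \o (fun y => U N * (h y * cos (phi N y)))).
    exact: (integrableZl measurableT (U N) (iC N)).
  have iVS : mu.-integrable setT (EFin \o (fun y => V N * (h y * sin (phi N y)))).
    exact: (integrableZl measurableT (V N) (iS N)).
  rewrite -(RintegralD _ iUC iVS)// -RintegralD//; last first.
    exact: (integrableD measurableT iUC iVS).
  apply: eq_Rintegral => y _.
  by rewrite /F /series/= big_nat_recr//= eUV; ring.
have Fcvg : (\int[mu]_y (F N y)%:E)%E @[N --> \oo] --> (\int[mu]_y (h y * g y)%:E)%E.
  apply: (@dominated_cvg _ _ _ mu setT _ (fun N y => (F N y)%:E)
     (fun y => (h y * g y)%:E) (fun y => (limn (series m))%:E * `|h y|%:E)%E) => //.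
  - by move=> N; apply/measurable_EFinP; exact: mF.
  - move=> y _; apply: cvg_EFin; first exact: nearW.
    (* Where [h] vanishes the expansion is not assumed, but there all [F N y] and the limit are
       0. *)
    rewrite /F/=; have [->|hy0] := eqVneq (h y) 0.
      by under eq_cvg do rewrite /= mul0r; rewrite mul0r; exact: cvg_cst.
    by apply: cvgMr; exact: hg.
  - by apply: integrableZl => //; exact: integrable_norm ih.
  - move=> N y _; rewrite /F -EFinM lee_fin normrM mulrC ler_wpM2r//.
have Facvg : `|\int[mu]_y (F N y)%:E|%E @[N --> \oo] -->
    `|\int[mu]_y (h y * g y)%:E|%E by exact: cvg_abse.
rewrite -(cvg_lim _ Facvg)//; apply: lime_le; first exact: cvgP Facvg.
apply: nearW => N.
have -> : (\int[mu]_y (F N y)%:E = (\int[mu]_y F N y)%:E)%E.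
  by rewrite /Rintegral fineK//; exact: integrable_fin_num (iF N).
rewrite FE; apply: le_trans (nneseries_lim_ge N _); last first.
  by move=> j _ _; rewrite lee_fin mulr_ge0// addr_ge0.
rewrite sumEFin lee_fin; apply: le_trans (ler_norm_sum _ _ _) _.
apply: ler_sum => j _; apply: le_trans (ler_normD _ _) _.
by rewrite !normrM mulrDr lerD// ler_wpM2r.
Qed.

End fourier_expansion.

(** * Test functions, the integral form of the commutator, and the choice of a box *)

Section function_spaces.
Context {R : realType} {n : nat}.
Local Notation E := (Rn R n).
Local Notation mu := (@lebn R n).

Lemma bfs_norm_indic_mul_le (X : banach_function_space R n) (A : set E)
    (u : E -> R) : measurable A -> measurable_fun setT u ->
  (forall y, `|u y| <= 1) -> (X (fun y => \1_A y * u y)%R <= X \1_A)%E.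
Proof.
move=> mA mu_ u1; apply: bfs_norm_le.
- by apply: measurable_funM => //; exact: measurable_indic.
- exact: measurable_indic.
- by apply: aeW => y; rewrite normrM ler_piMr.
Qed.

Lemma bfs_set_indic_mul (X : banach_function_space R n) (A : set E)
    (u : E -> R) : measurable A -> bounded_set A -> measurable_fun setT u ->
  (forall y, `|u y| <= 1) -> bfs_set X (fun y => \1_A y * u y).
Proof.
move=> mA bA mu_ u1; split.
  by apply: measurable_funM => //; exact: measurable_indic.
by apply: le_lt_trans (bfs_norm_indic _ mA bA); exact: bfs_norm_indic_mul_le.
Qed.

Lemma bfs_norm_indic_gt0 (X : banach_function_space R n) (A : set E) :
  measurable A -> (0 < mu A)%E -> (0 < X \1_A)%E.
Proof.
move=> mA A0; have mI : measurable_fun setT (\1_A : E -> R) by exact: measurable_indic.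
rewrite lt_neqAle bfs_norm_ge0// andbT eq_sym; apply/eqP => /bfs_norm_eq0.
move=> /(_ mI)[N [mN N0 AN]]; move: A0; rewrite ltNge => /negP; apply.
rewrite -N0; apply: le_measure; rewrite ?inE// => x Ax; apply: AN => /=.
by rewrite indicE mem_set//; apply/eqP; rewrite oner_eq0.
Qed.

Lemma supp_mul_subr (b f : E -> R) : supp (fun y => b y * f y) `<=` supp f.
Proof. by apply: closure_subset => y /=; apply: contraNN => /eqP->; rewrite mulr0. Qed.

Lemma supp_indic_mul_subset (A : set E) (u : E -> R) : closed A ->
  supp (fun y => \1_A y * u y) `<=` A.
Proof.
move=> cA; rewrite [X in _ `<=` X](closure_id A).1//; apply: closure_subset.
move=> y /=; rewrite indicE; case: (boolP (y \in A)) => [/set_mem//|_].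
by rewrite mul0r eqxx.
Qed.

(** Since [b * f] is supported in the support of [f], both representations hold at [x], and their
    difference has the factor [b x - b y]. *)
Lemma commutator_integral (T : (E -> R) -> E -> R) (K b f : E -> R) (x : E) :
  represented_off_support T K f ->
  represented_off_support T K (fun y => b y * f y) -> ~ supp f x ->
  mu.-integrable setT (EFin \o (fun y => (b x - b y) * K (x - y) * f y)) /\
  commutator b T f x = \int[mu]_y ((b x - b y) * K (x - y) * f y).
Proof.
move=> Tf Tbf xf.
have [i1 e1] := Tf x xf.
have [i2 e2] := Tbf x (fun h => xf (supp_mul_subr _ _ _ h)).
have i3 : mu.-integrable setT (EFin \o (fun y => b x * (K (x - y) * f y))).
  exact: (integrableZl measurableT (b x) i1).
rewrite (_ : (fun y => (b x - b y) * K (x - y) * f y) =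
   (fun y => b x * (K (x - y) * f y) - K (x - y) * (b y * f y))); last first.
  by apply/funext => y; ring.
split; first exact: (integrableB measurableT i3 i2).
by rewrite RintegralB// RintegralZl// /commutator e1 e2.
Qed.

(** The origin is avoided because homogeneity constrains [K] only away from 0, and because a scaled
    difference lying in the box then forces the two points to be distinct. *)
Lemma sub_box_euclidean_ball (z : E) (r : R) : (0 < n)%N -> 0 < r ->
  exists (z' : E) (eta : R), 0 < eta /\
    forall w : E, (forall i, `|w 0 i - z' 0 i| <= eta) ->
      euclidean_ball z r w /\ w != 0.
Proof.
move=> n0 r0; pose eta := r / (4 * n.+1%:R).
have eta0 : 0 < eta by rewrite divr_gt0// mulr_gt0.
(* Each coordinate of the centre is pushed away from 0 by [2 * eta], so it cannot vanish on the box.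
   Coordinates then differ from those of [z] by at most [3 * eta], and [9 * n < 16 * (n + 1) ^ 2]
   keeps the box inside the ball. *)
exists (\row_i (z 0 i + if 0 <= z 0 i then 2 * eta else - (2 * eta))), eta.
split=> // w hw; split; last first.
  apply/eqP => w0; have := hw (Ordinal n0); rewrite w0 !mxE.
  by case: ifPn => z0; rewrite ler_norml => /andP[]; lra.
have eta3 : 0 <= 3 * eta by apply: mulr_ge0 => //; exact: ltW.
have wz i : ((w - z) 0 i) ^+ 2 <= (3 * eta) ^+ 2.
  have := hw i; rewrite !mxE ler_norml => /andP[h1 h2].
  rewrite -[leLHS]real_normK ?num_real// ler_pXn2r ?nnegrE//.
  by rewrite ler_norml; apply/andP; split; move: h1 h2; case: ifPn => _; lra.
rewrite /euclidean_ball/= -[ltRHS](gtr0_norm r0) -sqrtr_sqr ltr_sqrt ?exprn_gt0//.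
apply: (@le_lt_trans _ _ (n%:R * (3 * eta) ^+ 2)).
  rewrite /dot -[X in X%:R * _](card_ord n) mulr_natl -sumr_const.
  by apply: ler_sum => i _; rewrite -expr2; exact: wz.
have -> : r = 4 * n.+1%:R * eta by rewrite /eta mulrC divfK// mulf_neq0.
move: eta eta0 {eta3 hw wz} => e e0.
rewrite !exprMn -[n.+1%:R]natr1.
have nn : 0 <= (n%:R : R) by [].
rewrite mulrA ltr_pM2r ?exprn_gt0//.
by move: (n%:R : R) nn => t t0; nra.
Qed.

End function_spaces.

(** * Pointwise bound of the oscillation by commutators *)

Section pointwise_estimate.
Context {R : realType} {n : nat}.
Local Notation E := (Rn R n).
Local Notation mu := (@lebn R n).

Lemma measurable_comp_dot (c : R -> R) (u : E) (t : R) : continuous c ->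
  measurable_fun setT (fun y : E => c (dot u (t *: y))).
Proof.
move=> cc; apply: (measurableT_comp (continuous_measurable_fun cc)).
rewrite (_ : (fun y => _) = (fun y => t * dot u y)).
  by apply: measurable_funM => //; exact: measurable_dot.
apply/funext => y; rewrite /dot mulr_sumr; apply: eq_bigr => i _.
by rewrite mxE mulrCA.
Qed.

(* If [x] lies in the cube [Q] with corner [a] and [y] in the translate [Q'],
   then [(x - y) / s] lies in the box around [w0] where the expansion of [1 / K]
   holds. *)
Lemma oscillation_le_commutators (X : banach_function_space R n)
    (T : (E -> R) -> E -> R) (K b : E -> R) (deg : R) (w0 : E) (eta : R)
    (p q : nat -> R) (nu : nat -> E) (a : E) (r : R) (x : E)
    (s := r / eta) (Q' := cube (a - s *: w0) r)
    (f := fun (c : R -> R) j (y : E) => \1_Q' y * c (dot (nu j) (s^-1 *: y))) :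
  0 < eta -> 0 < r -> (0 < mu Q')%E -> cube a r x ->
  homogeneous_kernel K deg ->
  (forall g, bfs_set X g -> represented_off_support T K g) ->
  (forall g, bfs_set X g -> represented_off_support T K (fun y => b y * g y)) ->
  locally_integrable_Rn b ->
  cvgn (series (fun j => `|p j| + `|q j|)) ->
  (forall w : E, (forall i, `|w 0 i - w0 0 i| <= eta) ->
    [/\ w != 0, K w != 0 &
      series (fun j => p j * cos (dot (nu j) w) - q j * sin (dot (nu j) w)) @ \oo
        --> (K w)^-1]) ->
  ((s `^ deg * (fine (mu Q') * `|b x - average b Q'|))%:E <= \sum_(j <oo)
     ((`|p j| + `|q j|) * (`|commutator b T (f cos j) x|
                         + `|commutator b T (f sin j) x|))%:E)%E.
Proof.
move=> eta0 r0 Q'0 Qx hK hTK hTKb hb cpq hw.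
have s0 : 0 < s by rewrite divr_gt0.
have sN0 : s != 0 by rewrite gt_eqF.
have etaE : eta = s^-1 * r by rewrite /s invf_div divfK ?gt_eqF.
have mQ' : measurable Q' by exact: measurable_cube.
have Q'fin : mu Q' = (fine (mu Q'))%:E by rewrite fineK// lebn_cube_fin.
have v0 : 0 < fine (mu Q') by rewrite -lte_fin -Q'fin.
(* Relative to the corners of their cubes, [x] and [y] have coordinates in [0, r]; these differ by
   at most [r], which becomes [eta] after division by [s]. *)
have box y : Q' y -> forall i, `|(s^-1 *: (x - y)) 0 i - w0 0 i| <= eta.
  move=> Q'y i; have := Qx i; have := Q'y i; rewrite !mxE etaE.
  rewrite -[X in `|_ - X|](mulKf sN0) -mulrBr normrM gtr0_norm ?invr_gt0// ler_pM2l ?invr_gt0//.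
  by rewrite ler_norml => /andP[? ?] /andP[? ?]; apply/andP; split; lra.
(* Taking [y = x] would put 0 into the box. Hence [x] is off the support of every test function on
   [Q']. *)
have xQ' : ~ Q' x.
  by move=> /box /hw[]; rewrite subrr scaler0 eqxx.
pose theta j := dot (nu j) (s^-1 *: x).
pose phi j (y : E) := dot (nu j) (s^-1 *: y).
pose h (y : E) := (b x - b y) * K (x - y) * \1_Q' y.
pose g (y : E) := (K (s^-1 *: (x - y)))^-1.
have comm (u : E -> R) : measurable_fun setT u -> (forall y, `|u y| <= 1) ->
    mu.-integrable setT (EFin \o (fun y => h y * u y)) /\
    commutator b T (fun y => \1_Q' y * u y) x = \int[mu]_y (h y * u y).
  move=> mu_ u1; rewrite /h; under [fun y => _ * u y]eq_fun do rewrite -mulrA.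
  have Xu : bfs_set X (fun y => \1_Q' y * u y).
    by apply: bfs_set_indic_mul => //; exact: bounded_cube.
  apply: commutator_integral; [exact: hTK|exact: hTKb|].
  by move=> /supp_indic_mul_subset => /(_ (closed_cube _ _)).
(* The multiplier 1 gives the integrability of [h] itself. *)
have ih : mu.-integrable setT (EFin \o h).
  have [|+ _] := comm (cst 1) (measurable_cst _).
    by move=> y; rewrite normr1.
  by under eq_fun do rewrite mulr1.
have mphi j : measurable_fun setT (phi j).
  by apply: (measurable_comp_dot id) => t; exact: cvg_id.
have hg y : h y != 0 -> series (fun j => p j * cos (theta j - phi j y) -
    q j * sin (theta j - phi j y)) @ \oo --> g y.
  rewrite /h mulf_eq0 negb_or indicE => /andP[_].
  case: (boolP (y \in Q')) => [/set_mem Q'y _|]; last by rewrite eqxx.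
  have [_ _] := hw _ (box _ Q'y).
  rewrite (_ : (fun j => _) = (fun j => p j * cos (theta j - phi j y) -
    q j * sin (theta j - phi j y)))//; apply/funext => j.
  have -> // : dot (nu j) (s^-1 *: (x - y)) = theta j - phi j y.
  rewrite /theta /phi /dot -sumrB; apply: eq_bigr => i _.
  by rewrite !mxE; ring.
have := normr_integral_fourier_le h g p q theta phi ih mphi cpq hg.
have fcos j : commutator b T (f cos j) x = \int[mu]_y (h y * cos (phi j y)).
  apply: (comm (fun y => cos (phi j y)) _ _).2.
    exact/measurable_comp_dot/continuous_cos.
  by move=> y; rewrite ler_norml cos_geN1 cos_le1.
have fsin j : commutator b T (f sin j) x = \int[mu]_y (h y * sin (phi j y)).
  apply: (comm (fun y => sin (phi j y)) _ _).2.
    exact/measurable_comp_dot/continuous_sin.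
  by move=> y; rewrite ler_norml sin_geN1 sin_le1.
under eq_eseriesr do rewrite -fcos -fsin.
apply: le_trans; rewrite le_eqVlt; apply/orP; left; apply/eqP.
have ib : mu.-integrable Q' (EFin \o b) by exact: integrable_cube.
have ibx : mu.-integrable Q' (EFin \o cst (b x)).
  apply/integrableP; split; first by apply/measurable_EFinP; exact: measurable_cst.
  by rewrite /= (integral_cst mu mQ' `|b x|%:E)/= Q'fin -EFinM ltry.
have ibb : mu.-integrable Q' (EFin \o (fun y => b x - b y)).
  exact: (integrableB mQ' ibx ib).
have -> : (\int[mu]_y (h y * g y)%:E =
    \int[mu]_(y in Q') (s `^ deg * (b x - b y))%:E)%E.
  rewrite [RHS]integral_mkcond; apply: eq_integral => y _.
  rewrite patchE /h indicE; case: (boolP (y \in Q')) => [/set_mem Q'y|_].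
    have [w_neq0 Kw_neq0 _] := hw _ (box _ Q'y).
    have := hK s _ s0 w_neq0; rewrite scalerA mulfV// scale1r => ->.
    by congr EFin; rewrite /g mulr1n; field.
  by rewrite mulr0 mul0r.
have -> : (\int[mu]_(y in Q') (s `^ deg * (b x - b y))%:E =
    (\int[mu]_(y in Q') (s `^ deg * (b x - b y)))%:E)%E.
  by rewrite /Rintegral fineK//; exact/integrable_fin_num/(integrableZl mQ' _ ibb).
rewrite RintegralZl// RintegralB// Rintegral_cst//= /average.
rewrite normrM ger0_norm ?powR_ge0//; congr (_ * _)%:E.
rewrite -[X in X * _](gtr0_norm v0) -normrM mulrBr mulVKf ?gt_eqF//.
by rewrite [b x * _]mulrC.
Qed.
End pointwise_estimate.

(** * Summation over the frequencies and the bound on the mean oscillation *)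

Lemma nneseries_scale_le {R : realType} (m : nat -> R) (G : R) :
  0 <= G -> (forall j, 0 <= m j) -> cvgn (series m) ->
  (\sum_(j <oo) (m j * G)%:E <= (limn (series m) * G)%:E)%E.
Proof.
move=> G0 m0 cm; apply: lime_le.
  by apply: is_cvg_nneseries => j _ _; rewrite lee_fin mulr_ge0.
apply: nearW => N; rewrite sumEFin lee_fin -mulr_suml ler_wpM2r//.
by apply: (nondecreasing_cvgn_le _ cm N); apply: nondecreasing_series.
Qed.

Theorem theorem1p1 (R : realType) (n : nat) (X Y : banach_function_space R n)
  (alpha : R) (halpha : 0 <= alpha < n%:R)
  (hXY : exists C : R, forall Q : set (Rn R n), is_cube Q ->
    (poweR (lebn Q) (- (alpha / n%:R))%R * assoc_norm Y \1_Q * X \1_Q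
       <= C%:E * lebn Q)%E)
  (T : (Rn R n -> R) -> Rn R n -> R) (hT : linear_operator_on X T)
  (K : Rn R n -> R) (hK : homogeneous_kernel K (- (n%:R - alpha)))
  (hTK : forall f, bfs_set X f -> represented_off_support T K f)
  (hB : exists (z : Rn R n) (r : R), 0 < r /\
    (forall x, euclidean_ball z r x -> K x != 0) /\
    abs_cvg_fourier (fun x => (K x)^-1) (euclidean_ball z r))
  (b : Rn R n -> R) (hb : locally_integrable_Rn b)
  (hTKb : forall f, bfs_set X f ->
    represented_off_support T K (fun x => b x * f x))
  (hbT : bounded_operator X Y (commutator b T)) :
  BMO b.
Proof.
have n0 : (0 < n)%N.
  by case/andP: halpha => a0 an; rewrite -(ltr0n R); exact: le_lt_trans an.
have [z [delta [delta0 [KN0 /abs_cvg_fourier_real[p [q [nu [cpq Kpq]]]]]]]] := hB.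
have [w0 [eta [eta0 hbox]]] := sub_box_euclidean_ball z delta n0 delta0.
have hw (w : Rn R n) : (forall i, `|w 0 i - w0 0 i| <= eta) ->
    [/\ w != 0, K w != 0 &
      series (fun j => p j * cos (dot (nu j) w) - q j * sin (dot (nu j) w)) @ \oo
        --> (K w)^-1].
  by move=> /hbox[wB w_neq0]; split=> //; [exact: KN0|exact: Kpq].
have [C hC] := hXY; have [A hA] := hbT.
pose m j : R := `|p j| + `|q j|.
have m0 j : 0 <= m j by rewrite addr_ge0.
pose kappa := fine (lebn (cube (0 : Rn R n) 1)).
have kappaE : lebn (cube (0 : Rn R n) 1) = kappa%:E.
  by rewrite fineK// lebn_unit_cube_fin.
(* [W] bounds every coordinate of [w0], so enlarging [Q] by [s * W] on each side captures the
   translate [Q']; [L] is the resulting side in units of [r]. *)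
pose W := \sum_i `|w0 0 i|.
have W0 : 0 <= W by apply: sumr_ge0.
have wW i : `|w0 0 i| <= W.
  by rewrite /W (bigD1 i)//= lerDl sumr_ge0.
pose L := 1 + 2 * W / eta.
have L0 : 0 < L by rewrite ltr_pwDl// divr_ge0 ?(ltW eta0)// mulr_ge0.
pose D := kappa * (L * eta) ^+ n.
pose S := limn (series m).
have S0 : 0 <= S.
  apply: limr_ge => //; apply: nearW => N; rewrite /series/=.
  by apply: sumr_ge0.
(* Adding 1 makes the operator bound strictly positive, as the duality estimate requires of its
   constant. *)
pose A' := `|A| + 1.
have A'0 : 0 < A' by rewrite ltr_wpDl.
(* [B] is chosen to solve the identity for [k * (B * v)] at the end. It is free of [r] and [s],
   hence the same for all cubes. *)
pose B := S * (2 * A' * (C * D * D `^ (alpha / n%:R))) / (kappa * eta ^+ n) ^+ 2.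
apply: (BMO_of_constants b B hb) => a r r0 Q0.
(* Every cube has measure [kappa] times a power of its side, so one cube of positive measure forces
   this. *)
have kappa0 : 0 < kappa.
  move: Q0; rewrite lebn_cube// kappaE -EFinM lte_fin.
  by rewrite pmulr_rgt0// exprn_gt0.
pose s := r / eta.
have s0 : 0 < s by rewrite divr_gt0.
have rE : r = s * eta by rewrite /s divfK ?gt_eqF.
pose Q := cube a r; pose Q' := cube (a - s *: w0) r.
pose P := cube (a - const_mx (s * W)) (L * r).
have Lr0 : 0 < L * r by rewrite mulr_gt0.
have LrE : L * r = r + 2 * (s * W) by rewrite /L /s; field; rewrite gt_eqF.
have mP : measurable P by exact: measurable_cube.
have mQ : measurable Q by exact: measurable_cube.
have mQ' : measurable Q' by exact: measurable_cube.
have QP : Q `<=` P.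
  move=> x Qx i; have := Qx i; rewrite !mxE LrE => /andP[h1 h2].
  by have sW0 := mulr_ge0 (ltW s0) W0; apply/andP; split; lra.
have Q'P : Q' `<=` P.
  move=> x Qx i; have := Qx i; rewrite !mxE LrE => /andP[h1 h2].
  have := wW i; rewrite ler_norml => /andP[/(ler_wpM2l (ltW s0)) h3].
  by move=> /(ler_wpM2l (ltW s0)) h4; apply/andP; split; lra.
pose v := kappa * r ^+ n.
have v0 : 0 < v by rewrite mulr_gt0// exprn_gt0.
have muQ : lebn Q = v%:E by rewrite /Q lebn_cube// kappaE -EFinM mulrC.
have muQ' : lebn Q' = v%:E by rewrite /Q' lebn_cube// kappaE -EFinM mulrC.
pose sigma := s ^+ n.
have sigma0 : 0 < sigma by rewrite exprn_gt0.
have vE : v = kappa * eta ^+ n * sigma by rewrite /v /sigma rE exprMn; ring.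
have D0 : 0 < D by rewrite mulr_gt0// exprn_gt0// mulr_gt0.
have Ds0 : 0 < D * sigma by rewrite mulr_gt0.
have muP : lebn P = (D * sigma)%:E.
  by rewrite /P lebn_cube// kappaE -EFinM /D /sigma rE !exprMn; congr EFin; ring.
have [xi xi0 XP] : exists2 xi : R, 0 < xi & X \1_P = xi%:E.
  have XPoo := bfs_norm_indic X mP (bounded_cube _ _).
  have XP0 : (0 < X \1_P)%E.
    by apply: bfs_norm_indic_gt0 => //; rewrite muP lte_fin.
  exists (fine (X \1_P)); first by rewrite fine_gt0// XP0.
  by rewrite fineK// ge0_fin_numE// ltW.
pose f (c : R -> R) j (y : Rn R n) := \1_Q' y * c (dot (nu j) (s^-1 *: y)).
(* The integral over [Q] is enlarged to [P], so that duality produces the associate norm of the same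
   cube on which the hypothesis on [X] and [Y] is used. *)
have comm_le (c : R -> R) j : continuous c -> (forall t, `|c t| <= 1) ->
    measurable_fun setT (commutator b T (f c j)) /\
    (\int[@lebn R n]_(x in Q) `|commutator b T (f c j) x|%:E <=
      (A' * xi)%:E * assoc_norm Y \1_P)%E.
  move=> cc c1.
  have mc := measurable_comp_dot c (nu j) s^-1 cc.
  have Xf : bfs_set X (f c j).
    by apply: bfs_set_indic_mul => //; exact: bounded_cube.
  have [mCf YCf] := hA _ Xf; split=> //.
  apply: (@le_trans _ _ (\int[@lebn R n]_(x in P) `|commutator b T (f c j) x|%:E)%E).
    apply: ge0_subset_integral => //; apply/measurable_EFinP.
    by apply: measurableT_comp; [exact: normr_measurable|exact: measurable_funTS].
  apply: le_integral_assoc_norm => //; first by rewrite mulr_gt0.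
  apply: le_trans YCf _; have [mf Xfoo] := Xf.
  have Xf0 := bfs_norm_ge0 X mf.
  have Xfxi : (X (f c j) <= xi%:E)%E.
    rewrite -XP; apply: le_trans (bfs_norm_indic_mul_le _ _ _ mQ' mc _) _ => //.
    apply: bfs_norm_le; [exact: measurable_indic|exact: measurable_indic|].
    apply: aeW => y; rewrite !indicE; case: (boolP (y \in Q')) => [/set_mem/Q'P|_].
      by move=> /mem_set ->.
    by rewrite normr0.
  move: (X (f c j)) Xf0 Xfxi => [t| |]//; rewrite !lee_fin => t0 txi.
  apply: (@le_trans _ _ (`|A| * t)); first by rewrite ler_wpM2r// ler_norm.
  by rewrite ler_pM// lerDl.
have cos1 (t : R) : `|cos t| <= 1 by rewrite ler_norml cos_geN1 cos_le1.
have sin1 (t : R) : `|sin t| <= 1 by rewrite ler_norml sin_geN1 sin_le1.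
have hcos j := comm_le cos j (@continuous_cos R) cos1.
have hsin j := comm_le sin j (@continuous_sin R) sin1.
have hP := hC P (is_cube_cube _ _ Lr0).
(* The hypothesis on [P] excludes [+oo], since the other factors on its left are positive and its
   right side is finite; a nonnegative integral bounded by a positive multiple of the associate norm
   excludes negative values. *)
have [beta beta0 YP] : exists2 beta : R, 0 <= beta & assoc_norm Y \1_P = beta%:E.
  have := (hcos 0%N).2; move: hP; rewrite XP muP poweR_EFin.
  case: (assoc_norm Y \1_P) => [beta _|h _|_ h].
  - move=> h; exists beta => //; rewrite -(pmulr_rge0 _ (mulr_gt0 A'0 xi0)).
    by rewrite -lee_fin; apply: le_trans h; exact: integral_ge0.
  - move: h; rewrite gt0_muley ?lte_fin ?powR_gt0//.
    by rewrite gt0_mulye ?lte_fin// -EFinM.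
  - have : (0 <= (A' * xi)%:E * -oo :> \bar R)%E.
      by apply: le_trans h; exact: integral_ge0.
    by rewrite gt0_muleNy ?lte_fin ?mulr_gt0.
have {hP} hP : beta * xi <= C * (D * sigma) * (D * sigma) `^ (alpha / n%:R).
  move: hP; rewrite XP muP YP poweR_EFin -!EFinM lee_fin powRN -mulrA.
  by rewrite ler_pdivrMl ?powR_gt0// [leRHS]mulrC.
exists (average b Q').
(* [k] is the factor of |b x - b_Q'| in the pointwise estimate. *)
pose k := s `^ (- (n%:R - alpha)) * v.
have k0 : 0 < k by rewrite mulr_gt0// powR_gt0.
rewrite -/Q muQ.
have mbc : measurable_fun Q (fun x => `|b x - average b Q'|%:E).
  apply/measurable_EFinP; apply: measurable_funTS.
  apply: measurableT_comp; first exact: normr_measurable.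
  by apply: measurable_funB => //; case: hb.
have mabs c j : measurable_fun setT (commutator b T (f c j)) ->
    measurable_fun Q (fun x => `|commutator b T (f c j) x|%:E).
  by move=> mcj; apply/measurable_EFinP/measurable_funTS/measurableT_comp.
have mcos j := mabs cos j (hcos j).1.
have msin j := mabs sin j (hsin j).1.
pose H j x : R := `|commutator b T (f cos j) x| + `|commutator b T (f sin j) x|.
have mH j : measurable_fun Q (fun x => (H j x)%:E).
  exact: (emeasurable_funD (mcos j) (msin j)).
have H0 j x : 0 <= H j x by rewrite addr_ge0.
pose G j x := m j * H j x.
have mG j : measurable_fun Q (fun x => (G j x)%:E).
  exact: (measurable_funeM (m j)%:E (mH j)).
have G0 j x : 0 <= G j x by rewrite mulr_ge0.
(* The pointwise estimate is integrated over [Q]; sum and integral are exchanged by nonnegativity,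
   and the factor 2 accounts for the cosine and sine terms. *)
have osc : (k%:E * \int[@lebn R n]_(x in Q) `|b x - average b Q'|%:E <=
    (S * (2 * (A' * xi * beta)))%:E)%E.
  rewrite -ge0_integralZl ?lee_fin ?(ltW k0)//.
  apply: (@le_trans _ _ (\int[@lebn R n]_(x in Q) \sum_(j <oo) (G j x)%:E)%E).
    apply: ge0_le_integral; first exact: mQ.
    - by move=> x _; rewrite mule_ge0// lee_fin ltW.
    - exact: measurable_funeM.
    - by apply: ge0_emeasurable_sum => // j x _ _; rewrite lee_fin.
    move=> x Qx; rewrite -EFinM /k -mulrA -[v]/(fine v%:E) -muQ'.
    apply: (oscillation_le_commutators X T K) => //.
    by rewrite -/s -/Q' muQ'.
  rewrite integral_nneseries//; last by move=> j x _; rewrite lee_fin.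
  apply: le_trans (nneseries_scale_le m (2 * (A' * xi * beta)) _ m0 cpq); last first.
    by rewrite !mulr_ge0// ltW.
  apply: lee_nneseries => [j _ _|j _].
    by apply: integral_ge0 => x _; rewrite lee_fin.
  under eq_integral do rewrite EFinM.
  rewrite ge0_integralZl ?lee_fin//; last by move=> x _; rewrite lee_fin.
  rewrite EFinM lee_wpmul2l ?lee_fin//.
  under eq_integral do rewrite EFinD.
  rewrite ge0_integralD//.
  rewrite mulrDl mul1r EFinD; apply: leeD.
    by rewrite (EFinM _ beta) -YP; exact: (hcos j).2.
  by rewrite (EFinM _ beta) -YP; exact: (hsin j).2.
have sdeg : s `^ (- (n%:R - alpha)) = sigma `^ (alpha / n%:R) / sigma.
  rewrite /sigma -powR_mulrn ?(ltW s0)// -powRrM mulrCA mulfV ?pnatr_eq0 ?gtn_eqF//.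
  by rewrite mulr1 -powRN -powRD ?(gt_eqF s0) ?implybT// opprB.
move: osc; rewrite -lee_pdivlMl// => /le_trans; apply.
rewrite -!EFinM lee_fin ler_pdivrMl//.
have -> : k * (B * v) = S * (2 * A' * (C * (D * sigma) * (D * sigma) `^ (alpha / n%:R))).
  rewrite powRM ?(ltW D0) ?(ltW sigma0)// /k sdeg /B vE.
  field.
  by rewrite !gt_eqF ?exprn_gt0.
rewrite ler_wpM2l// -!mulrA ler_wpM2l// ler_wpM2l ?(ltW A'0)// mulrC.
by rewrite !mulrA in hP *.
Qed.
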